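(* Let $\sigma_{kk}$ be the smallest singular value of $\widetilde U_k=M^{1/2}U_kL_k^{-1/2}$ and let $\sigma_{k-1,k-1}$ be the smallest singular value of $\widetilde U_{k-1}=M^{1/2}U_{k-1}L_{k-1}^{-1/2}$. Define $$u_{i,j}=(u_{n+i},u_{n+j})_M-\sigma_{kk}^2(L_k)_{ij},\qquad i,j=0,1,\ldots,k,$$ and assume that $$\sigma_{kk}<\sigma_{k-1,k-1}.$$ For scalars or vectors $v_0,\ldots,v_k$, let $$D(v_0,v_1,\ldots,v_k)=\begin{vmatrix} v_0 & v_1 & \cdots & v_k \\ {u}_{0,0} & u_{0,1} & \cdots & u_{0,k} \\ {u}_{1,0} & u_{1,1} & \cdots & u_{1,k} \\ \vdots & \vdots & & \vdots \\ {u}_{k-1,0} & u_{k-1,1} & \cdots & u_{k-1,k} \end{vmatrix},$$ where, when the $v_i$ are vectors, the determinant is defined via its expansion with respect to its first row. Then, provided $D(1,1,\ldots,1)\ne0$, the SVD-MPE approximation $s_{n,k}$ exists and has the determinant representation $$s_{n,k}=\frac{D(x_n,x_{n+1},\ldots,x_{n+k})}{D(1,1,\ldots,1)}.$$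
   Context: Let $\{x_m\}_{m\ge0}$ be a sequence of vectors in $\mathbb{C}^N$, and put $u_m=x_{m+1}-x_m$ (single-indexed vectors $u_m$ are not to be confused with the doubly-indexed scalars $u_{i,j}$ of the claim). For a fixed integer $n\ge0$ and an integer $k\ge1$ with $k+1\le N$, let $U_k=[\,u_n\,|\,u_{n+1}\,|\,\cdots\,|\,u_{n+k}\,]\in\mathbb{C}^{N\times(k+1)}$ and $U_{k-1}=[\,u_n\,|\,\cdots\,|\,u_{n+k-1}\,]$. Let $M\in\mathbb{C}^{N\times N}$ and $L_k\in\mathbb{C}^{(k+1)\times(k+1)}$ be hermitian positive definite; the entries of $L_k$ are indexed as $(L_k)_{ij}$, $i,j=0,1,\ldots,k$, and $L_{k-1}$ is the principal submatrix of $L_k$ obtained by deleting its last row and last column (it is again hermitian positive definite). $M^{1/2}$, $L_k^{1/2}$, $L_{k-1}^{1/2}$ denote hermitian positive definite square roots, with inverses $L_k^{-1/2}$, $L_{k-1}^{-1/2}$. Inner product and norms: $(a,b)_M=a^*Mb$, $\|a\|_M=\sqrt{(a,a)_M}$ on $\mathbb{C}^N$; $\|a\|_{L_k}=\sqrt{a^*L_ka}$ on $\mathbb{C}^{k+1}$; $\|a\|_2=\sqrt{a^*a}$. SVD-MPE: let $\sigma_{k0}\ge\cdots\ge\sigma_{kk}$ be the singular values of $\widetilde U_k$, and let $h_{kk}$ be a right singular vector for $\sigma_{kk}$, i.e. $\widetilde U_k^*\widetilde U_kh_{kk}=\sigma_{kk}^2h_{kk}$, $\|h_{kk}\|_2=1$.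 The vector $c=[c_0,\ldots,c_k]^T=L_k^{-1/2}h_{kk}$ is the optimal solution of $\min_c\|U_kc\|_M$ subject to $\|c\|_{L_k}=1$. The SVD-MPE approximation is $s_{n,k}=\sum_{i=0}^k\gamma_ix_{n+i}$ with $\gamma_i=c_i/\sum_{j=0}^kc_j$; it is said to exist if and only if $\sum_{j=0}^kc_j\ne0$. *)

(* Defs.v *)
From HB Require Import structures.
From mathcomp Require Import all_boot all_order all_algebra.
From mathcomp Require Export sesquilinear spectral.
From mathcomp Require Export reals complex.

Set Implicit Arguments.
Unset Strict Implicit.
Unset Printing Implicit Defensive.

Import Order.TTheory GRing.Theory Num.Theory.
Local Open Scope ring_scope.
Local Open Scope sesquilinear_scope.

Section Definitions.
Variable C : numClosedFieldType.

(* (a, b)_A = a^* A b, conjugate-linear in the first argument *)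
Definition inner N (A : 'M[C]_N) (a b : 'cV[C]_N) : C :=
  (a^t* *m A *m b) 0 0.

Definition norm2 N (a : 'cV[C]_N) : C := sqrtC ((a^t* *m a) 0 0).

Definition hpd N (A : 'M[C]_N) : Prop :=
  A \is hermsymmx /\ forall a : 'cV[C]_N, a != 0 -> 0 < inner A a a.

(* This determines S uniquely from A, and such an S exists as soon as A is
   hermitian positive definite. *)
Definition hpd_sqrt N (S A : 'M[C]_N) : Prop := hpd S /\ S *m S = A.

(* The eigenvalues of the hermitian matrix A^* A, with multiplicity, are real
   and nonnegative, so >= is total on the list below.  It has p entries, which
   are the singular values of A in the usual sense when p <= N. *)
Definition singular_values N p (A : 'M[C]_(N, p)) : seq C :=
  sort >=%R [seq sqrtC (spectral_diag (A^t* *m A) 0 i) | i : 'I_p].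

(* the i-th largest singular value, counting from i = 0 *)
Definition singval N p (A : 'M[C]_(N, p)) (i : nat) : C :=
  (singular_values A)`_i.

Definition right_singular_vector N p (A : 'M[C]_(N, p)) (s : C)
    (h : 'cV[C]_p) : Prop :=
  (A^t* *m A) *m h = s ^+ 2 *: h /\ norm2 h = 1.

Definition diff N (x : nat -> 'cV[C]_N) (m : nat) : 'cV[C]_N :=
  x m.+1 - x m.

(* p is the number of columns: U_k is diff_mx x n k.+1. *)
Definition diff_mx N (x : nat -> 'cV[C]_N) (n p : nat) : 'M[C]_(N, p) :=
  \matrix_(i < N, j < p) diff x (n + j)%N i 0.

Definition del_last k (L : 'M[C]_k.+1) : 'M[C]_k :=
  row' ord_max (col' ord_max L).

Definition umx N (M : 'M[C]_N) (x : nat -> 'cV[C]_N) (n k : nat)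
    (L : 'M[C]_k.+1) (sigma : C) : 'M[C]_k.+1 :=
  \matrix_(i, j) (inner M (diff x (n + i)%N) (diff x (n + j)%N) -
                  sigma ^+ 2 * L i j).

(* first row v, then the rows 0, ..., k-1 of u *)
Definition bordered k (u : 'M[C]_k.+1) (v : 'rV[C]_k.+1) : 'M[C]_k.+1 :=
  col_mx v (row' ord_max u).

Definition Dscal k (u : 'M[C]_k.+1) (v : 'I_k.+1 -> C) : C :=
  \det (bordered u (\row_j v j)).

(* The cofactors along the first row do not depend on that row, so any row can
   stand in for the vectors v j. *)
Definition Dvec N k (u : 'M[C]_k.+1) (v : 'I_k.+1 -> 'cV[C]_N) : 'cV[C]_N :=
  \sum_(j < k.+1) cofactor (bordered u 0) ord0 j *: v j.

Definition svd_mpe_exists k (c : 'cV[C]_k.+1) : Prop :=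
  \sum_(j < k.+1) c j 0 != 0.

Definition svd_mpe N (x : nat -> 'cV[C]_N) (n k : nat) (c : 'cV[C]_k.+1) :
    'cV[C]_N :=
  \sum_(i < k.+1) (c i 0 / \sum_(j < k.+1) c j 0) *: x (n + i)%N.

End Definitions.

(* Main.v *)
Require Import Defs.
From HB Require Import structures.
From mathcomp Require Import all_boot all_order all_algebra.
From mathcomp Require Import reals complex.

Set Implicit Arguments.
Unset Strict Implicit.
Unset Printing Implicit Defensive.

Import Order.TTheory GRing.Theory Num.Theory.
Local Open Scope ring_scope.
Local Open Scope sesquilinear_scope.

(* The singular vector equation reads G c = sigma^2 L c with G = U^* M U, so
   c is annihilated by u = G - sigma^2 L.  Hence the bordered matrix B with
   first row v sends c to (v . c) e_0, and multiplying by the adjugate of B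
   gives Cramer's rule det B * c_j = (v . c) * cofactor_{0 j}.  For
   v = (1, ..., 1), a nonzero det B forces the sum of the c_j to be nonzero,
   and the gamma_j are then the cofactors divided by det B. *)

Section BorderedCramer.
Variable C : numClosedFieldType.

Lemma adjmxM m n p (A : 'M[C]_(m, n)) (B : 'M[C]_(n, p)) :
  (A *m B)^t* = B^t* *m A^t*.
Proof. by rewrite trmx_mul map_mxM. Qed.

Lemma hpd_adj N (A : 'M[C]_N) : hpd A -> A^t* = A.
Proof. by case=> /is_hermitianmxP; rewrite expr0 scale1r => <-. Qed.

(** A nonzero kernel vector would make the quadratic form vanish. [det0P] yields a row vector, hence
    the passage to the transpose. *)
Lemma hpd_unitmx N (A : 'M[C]_N) : hpd A -> A \in unitmx.
Proof.
case=> _ Apos; rewrite -unitmx_tr unitmxE unitfE; apply/negP => /det0P[v v0 vA].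
have := Apos v^T; rewrite trmx_eq0 => /(_ v0).
have -> : inner A v^T v^T = 0.
  by rewrite /inner -mulmxA -[A]trmxK -trmx_mul vA trmx0 mulmx0 mxE.
by rewrite ltxx.
Qed.

Lemma umxE N (M : 'M[C]_N) (x : nat -> 'cV[C]_N) n k (L : 'M[C]_k.+1) s :
  umx M x n L s =
    (diff_mx x n k.+1)^t* *m M *m diff_mx x n k.+1 - s ^+ 2 *: L.
Proof.
apply/matrixP => i j; rewrite !mxE /inner mxE; congr (_ - _).
apply: eq_bigr => l _; rewrite !mxE; congr (_ * _).
by apply: eq_bigr => q _; rewrite !mxE.
Qed.

Lemma umx_right_singular N (M Mh : 'M[C]_N) (x : nat -> 'cV[C]_N) n k
    (L Lh : 'M[C]_k.+1) s (h : 'cV[C]_k.+1) :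
  hpd_sqrt Mh M -> hpd_sqrt Lh L ->
  right_singular_vector (Mh *m diff_mx x n k.+1 *m invmx Lh) s h ->
  umx M x n L s *m (invmx Lh *m h) = 0.
Proof.
move=> [hMh <-] [hLh <-] [eqh _]; have Lu := hpd_unitmx hLh.
have adjV : Lh *m (invmx Lh)^t* = 1%:M.
  by rewrite -{1}(hpd_adj hLh) -adjmxM mulVmx // trmx1 map_mx1.
(* By [adjV], [Lh] cancels the leftmost factor of the normal equation, leaving [G c = s^2 Lh h]; and
   [Lh h = L c] since [L = Lh Lh]. *)
have := congr1 (mulmx Lh) eqh.
rewrite umxE !adjmxM (hpd_adj hMh) !mulmxA adjV mul1mx => eqLh.
rewrite !mulmxBl eqLh -!scalemxAl -[Lh *m Lh *m _]mulmxA mulmxV //.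
by rewrite mulmx1 scalemxAr subrr.
Qed.

(** Deleting row 0 removes the only row where [v] or [w] occurs. This lets the zero-row cofactors of
    [Dvec] serve for the row of ones. *)
Lemma cofactor_bordered k (u : 'M[C]_k.+1) (v w : 'rV[C]_k.+1) j :
  cofactor (bordered u v) ord0 j = cofactor (bordered u w) ord0 j.
Proof.
congr (_ * \det _); apply/matrixP => a b; rewrite !mxE.
by case: splitP => // -[[|?] ?].
Qed.

Lemma bordered_cramer k (u : 'M[C]_k.+1) (v : 'I_k.+1 -> C) (c : 'cV[C]_k.+1) j :
  u *m c = 0 ->
  Dscal u v * c j 0 = (\sum_i v i * c i 0) * cofactor (bordered u 0) ord0 j.
Proof.
move=> uc0; set B := bordered u (\row_i v i).
have Bc : B *m c = (\sum_i v i * c i 0) *: delta_mx ord0 0.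
  have r0 : row' ord_max u *m c = 0.
    by rewrite row'Esub mul_rowsub_mx uc0; apply/matrixP=> a b; rewrite !mxE.
  have -> : B *m c = col_mx ((\row_i v i) *m c) (row' ord_max u *m c).
    (* The block rule holds here only up to conversion of [k.+1] with [1 + k]. *)
    exact: (mul_col_mx (\row_i v i) (row' ord_max u) c).
  rewrite r0; apply/matrixP => a b.
  rewrite [b]ord1 mxE; case: splitP => a' aE; rewrite !mxE.
    have -> : a = ord0 by apply: val_inj; rewrite /= aE [a']ord1.
    by rewrite eqxx mulr1; apply: eq_bigr => i _; rewrite mxE.
  by case: eqP aE => [->|_ _]; rewrite ?mulr0.
(* The adjugate is the transposed cofactor matrix, so its entry [(j, 0)] is the cofactor at
   [(0, j)]. *)
have := congr1 (fun A => (\adj B *m A) j 0) Bc.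
rewrite /= mulmxA mul_adj_mx mul_scalar_mx -scalemxAr -colE !mxE => ->.
by rewrite (cofactor_bordered _ _ 0).
Qed.

End BorderedCramer.

Theorem theorem2 (R : realType) (N n k : nat)
  (hk : (1 <= k)%N) (hkN : (k + 1 <= N)%N)
  (x : nat -> 'cV[R[i]]_N)
  (M Mh : 'M[R[i]]_N) (L Lh : 'M[R[i]]_k.+1) (Lh' : 'M[R[i]]_k)
  (hM : hpd M) (hL : hpd L)
  (hMh : hpd_sqrt Mh M) (hLh : hpd_sqrt Lh L)
  (hLh' : hpd_sqrt Lh' (del_last L))
  (h : 'cV[R[i]]_k.+1) :
  let Ut := Mh *m diff_mx x n k.+1 *m invmx Lh in
  let Ut' := Mh *m diff_mx x n k *m invmx Lh' in
  let sigma := singval Ut k in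
  let sigma' := singval Ut' k.-1 in
  let u := umx M x n L sigma in
  let c := invmx Lh *m h in
  right_singular_vector Ut sigma h ->
  sigma < sigma' ->
  Dscal u (fun=> 1) != 0 ->
  svd_mpe_exists c /\
  svd_mpe x n c =
    (Dscal u (fun=> 1))^-1 *: Dvec u (fun j : 'I_k.+1 => x (n + j)%N).
Proof.
move=> Ut Ut' sigma sigma' u c hsv _ D0.
have uc0 : u *m c = 0 by apply: umx_right_singular hsv.
have cramer j : Dscal u (fun=> 1) * c j 0 =
    (\sum_i c i 0) * cofactor (bordered u 0) ord0 j.
  rewrite (bordered_cramer _ _ uc0); congr (_ * _).
  by apply: eq_bigr => i _; rewrite mul1r.
have sum_c : \sum_i c i 0 != 0.
  (* A zero sum would give [c = 0] by Cramer's rule, hence [h = Lh c = 0], against the unit norm of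
     [h]. *)
  apply/eqP => s0; have c0 : c = 0.
    apply/matrixP => j l; rewrite [l]ord1 [RHS]mxE.
    by apply: (mulfI D0); rewrite cramer s0 mul0r mulr0.
  have h0 : h = 0 by rewrite -(mulKVmx (hpd_unitmx hLh.1) h) -/c c0 mulmx0.
  case: hsv => _ /eqP.
  by rewrite /norm2 h0 mulmx0 mxE sqrtC0 eq_sym oner_eq0.
split=> //; rewrite /svd_mpe /Dvec scaler_sumr; apply: eq_bigr => j _.
(* Clearing the determinant reduces equality of the coefficients of each [x (n + j)] to Cramer's
   rule divided by the sum. *)
rewrite scalerA; congr (_ *: _); apply: (mulfI D0).
by rewrite mulrA cramer mulVKf // mulrAC mulfV // mul1r.
Qed.
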